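(* For every set $\Lambda$ of $\mathit{LTL}$-formulas and every $\mathit{LTL}$-formula $A$, if $\Lambda\vdash_{\mathit{LTL}} A$ then $\Lambda\models_{\mathit{LTL}} A$.
   Context: Fix a set $\mathcal{P}$ of propositional symbols. $\mathit{LTL}$-formulas: $A ::= p \mid \bot \mid A\supset A \mid \mathsf{G}A \mid \mathsf{X}A \mid A\,\mathsf{U}\,A$. $\mathit{LTL}_\nabla$-formulas: $A ::= p \mid \bot \mid A\supset A \mid \mathsf{G}A \mid \mathsf{X}A \mid \nabla A$. Abbreviations: $\neg A := A\supset\bot$, $A\vee B := \neg A\supset B$, $A\wedge B := \neg(\neg A\vee\neg B)$, $\mathsf{F}A := \neg\mathsf{G}\neg A$. Translation $(\cdot)^*$: $p^*=p$, $\bot^*=\bot$, $(A\supset B)^*=A^*\supset B^*$, $(\mathsf{G}A)^*=\mathsf{G}A^*$, $(\mathsf{X}A)^*=\mathsf{X}A^*$, $(A\,\mathsf{U}\,B)^* = B^*\vee \mathsf{F}(\mathsf{X}B^*\wedge\nabla A^* )$. $\mathit{LTL}^l$-formulas $A^l$ and $\mathit{LTL}^{l\nabla}$-formulas $A^{l\nabla}$: $A^l ::= p \mid \bot \mid A^l\supset A^l \mid \mathsf{G}A^{l\nabla} \mid \mathsf{X}A^{l\nabla}$, $A^{l\nabla} ::= A^l \mid A^{l\nabla}\supset A^{l\nabla} \mid \nabla A^{l\nabla}$. $\mathit{LTL}$ semantics: a model is $\mathcal{M}=\langle\mathbb{N},\mathcal{V}\rangle$, $\mathcal{V}:\mathbb{N}\to2^{\mathcal{P}}$;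 $\mathcal{M},n\models_{\mathit{LTL}}p$ iff $p\in\mathcal{V}(n)$; $\bot$ never true; $\supset$ classical; $\mathsf{G}A$ at $n$ iff $A$ at all $m\ge n$; $\mathsf{X}A$ at $n$ iff $A$ at $n+1$; $A\,\mathsf{U}\,B$ at $n$ iff some $n'\ge n$ has $B$ and $A$ holds at all $m$ with $n\le m<n'$. $\Lambda\models_{\mathit{LTL}}A$ iff every model in which all formulas of $\Lambda$ hold at every point has $A$ holding at every point. Labels: fix a denumerable set $\mathcal{L}$ of labels; sequences are elements of $\mathcal{L}^+$; labeled formulas $\alpha:A$ ($\alpha$ a sequence, $A$ an $\mathit{LTL}_\nabla$-formula); relational formulas $b\leqslant c$, $b\lhd c$; generic formula = either; in $\alpha b_1\ldots b_k$ the prefix $\alpha$ may be empty. The natural deduction system $\mathcal{N}(\mathit{LTL}_\nabla)$ (''from $X$ derived from $[H]$'' means a subderivation of $X$ in which assumptions $H$ are discharged; $\varphi[c/b]$ substitutes label $c$ for $b$): ($\bot E$) from $\alpha_2:\bot$ derived from $[\alpha_1:A\supset\bot]$ infer $\alpha_1:A$. ($\supset I$) from $\alpha:B$ derived from $[\alpha:A]$ infer $\alpha:A\supset B$. ($\supset E$) from $\alpha:A\supset B$, $\alpha:A$ infer $\alpha:B$. ($\mathsf{G}I$) from $\alpha b_1b_2:A$ derived from $[b_1\leqslant b_2]$ infer $\alpha b_1:\mathsf{G}A$. ($\mathsf{G}E$) from $\alpha b_1:\mathsf{G}A$, $b_1\leqslant b_2$ infer $\alpha b_1b_2:A$. ($\mathsf{X}I$),($\mathsf{X}E$):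 the same with $\mathsf{X}$ and $\lhd$. ($\nabla I$) from $\alpha b_1b_2:A$ derived from $[b_1\leqslant b_2],[b_2\leqslant b_3]$ infer $\alpha b_1b_3:\nabla A$. ($\nabla E$) from $\alpha b_1b_3:\nabla A$, $b_1\leqslant b_2$, $b_2\leqslant b_3$ infer $\alpha b_1b_2:A$. ($\mathit{ser}_\lhd$) from $\alpha:A$ derived from $[b_1\lhd b_2]$ infer $\alpha:A$. ($\mathit{lin}_\lhd$) from $b_1\lhd b_2$, $b_1\lhd b_3$, generic $\varphi$, and $\alpha:A$ derived from $[\varphi[b_3/b_2]]$ infer $\alpha:A$. ($\mathit{refl}_\leqslant$) from $\alpha:A$ derived from $[b_1\leqslant b_1]$ infer $\alpha:A$. ($\mathit{trans}_\leqslant$) from $b_1\leqslant b_2$, $b_2\leqslant b_3$, $\alpha:A$ derived from $[b_1\leqslant b_3]$ infer $\alpha:A$. ($\mathit{last}$) from $\beta b:A^l$ infer $\alpha b:A^l$ ($A^l$ an $\mathit{LTL}^l$-formula). ($\mathit{eq}_\leqslant$) from $b_1\leqslant b_2$, $b_2\leqslant b_1$, $\alpha b_1:A$ infer $\alpha b_2:A$. ($\mathit{split}_\leqslant$) from $b_1\leqslant b_2$, generic $\varphi$, $\alpha:A$ derived from $[\varphi[b_2/b_1]]$, and $\alpha:A$ derived from $[b_1\lhd b'],[b'\leqslant b_2]$ infer $\alpha:A$. ($\mathit{base}_\leqslant$) from $b_1\lhd b_2$, $\alpha:A$ derived from $[b_1\leqslant b_2]$ infer $\alpha:A$. ($\mathit{ind}$)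 from $\alpha b_0:A$, $b_0\leqslant b$, and $\alpha b_j:A$ derived from $[b_0\leqslant b_i],[b_i\lhd b_j],[\alpha b_i:A]$ infer $\alpha b:A$. Freshness side conditions: the discharged new label ($b_2$ in $\mathsf{G}I,\mathsf{X}I,\nabla I,\mathit{ser}_\lhd$; $b'$ in $\mathit{split}_\leqslant$; $b_i,b_j$ in $\mathit{ind}$) must differ from the other labels named in the rule and must not occur in any assumption of the corresponding premise other than the assumptions discharged by the rule. An $\mathit{LTL}$-derivation is a derivation in $\mathcal{N}(\mathit{LTL}_\nabla)$ for which there is a single label $b$ such that its conclusion and each of its open assumptions has the form $b:B^*$ for some $\mathit{LTL}$-formula $B$. $\Lambda\vdash_{\mathit{LTL}}A$ means there is an $\mathit{LTL}$-derivation of $b:A^*$ from open assumptions in a set $\Phi$ with $\Lambda=\{B\mid b:B^*\in\Phi\}$. *)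

(* Defs.v *)
From mathcomp Require Import all_boot.
From mathcomp Require Import classical_sets.

Set Implicit Arguments.
Unset Strict Implicit.
Unset Printing Implicit Defensive.

Local Open Scope classical_set_scope.

Section Formulas.
Variable P : Type.

Inductive ltl : Type :=
| LVar of P
| LBot
| LImp of ltl & ltl
| LG of ltl
| LX of ltl
| LU of ltl & ltl.

(* [NNabla] is the history operator written with a nabla. *)
Inductive ltln : Type :=
| NVar of P
| NBot
| NImp of ltln & ltln
| NG of ltln
| NX of ltln
| NNabla of ltln.

Definition NNot (A : ltln) : ltln := NImp A NBot.
Definition NOr (A B : ltln) : ltln := NImp (NNot A) B.
Definition NAnd (A B : ltln) : ltln := NNot (NOr (NNot A) (NNot B)).
Definition NF (A : ltln) : ltln := NNot (NG (NNot A)).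

Fixpoint star (A : ltl) : ltln :=
  match A with
  | LVar p => NVar p
  | LBot => NBot
  | LImp A B => NImp (star A) (star B)
  | LG A => NG (star A)
  | LX A => NX (star A)
  | LU A B => NOr (star B) (NF (NAnd (NX (star B)) (NNabla (star A))))
  end.

(* The two sublanguages LTL^l and LTL^{l nabla}, carved out of [ltln] as
   predicates following their mutual grammar. *)
Inductive is_l : ltln -> Prop :=
| is_l_var p : is_l (NVar p)
| is_l_bot : is_l NBot
| is_l_imp A B : is_l A -> is_l B -> is_l (NImp A B)
| is_l_G A : is_ln A -> is_l (NG A)
| is_l_X A : is_ln A -> is_l (NX A)
with is_ln : ltln -> Prop :=
| is_ln_l A : is_l A -> is_ln A
| is_ln_imp A B : is_ln A -> is_ln B -> is_ln (NImp A B)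
| is_ln_nabla A : is_ln A -> is_ln (NNabla A).

Fixpoint sat (V : nat -> set P) (n : nat) (A : ltl) : Prop :=
  match A with
  | LVar p => V n p
  | LBot => False
  | LImp A B => sat V n A -> sat V n B
  | LG A => forall m, n <= m -> sat V m A
  | LX A => sat V n.+1 A
  | LU A B => exists n', [/\ n <= n', sat V n' B &
                             forall m, n <= m < n' -> sat V m A]
  end.

Definition ltl_entails (Lam : set ltl) (A : ltl) : Prop :=
  forall V : nat -> set P,
    (forall B, Lam B -> forall n, sat V n B) -> forall n, sat V n A.

End Formulas.

Arguments LBot {P}.
Arguments NBot {P}.

Definition denumerable (L : Type) : Prop := exists f : nat -> L, bijective f.

Section Labels.
Variables (P : Type) (L : eqType).

(* Nonempty sequences of labels: the pair [(al, b)] is the sequence [al b] with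
   last label [b] and possibly empty prefix [al].  So [al b1 b2] is
   [(rcons al b1, b2)]. *)
Definition lseq : Type := (seq L * L)%type.

Definition labels_of (s : lseq) : seq L := rcons s.1 s.2.

Inductive generic : Type :=
| Lab of lseq & ltln P
| Le of L & L
| Succ of L & L.

Definition occurs (b : L) (phi : generic) : Prop :=
  match phi with
  | Lab s _ => b \in labels_of s
  | Le c d | Succ c d => b \in [:: c; d]
  end.

Definition subst_label (c b x : L) : L := if x == b then c else x.

(* [subst c b phi] is phi[c/b]: [c] replaces [b]. *)
Definition subst (c b : L) (phi : generic) : generic :=
  match phi with
  | Lab s A => Lab (map (subst_label c b) s.1, subst_label c b s.2) A
  | Le x y => Le (subst_label c b x) (subst_label c b y)
  | Succ x y => Succ (subst_label c b x) (subst_label c b y)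
  end.

Definition absent (b : L) (Gam : set generic) : Prop :=
  forall phi, Gam phi -> ~ occurs b phi.

(* [deriv Gam phi]: there is a derivation with conclusion [phi] whose set of
   open assumptions is exactly [Gam].  Each premise carries its own open
   assumptions; a rule discharging [H] removes [H] from those of the premise
   concerned (vacuous discharge is allowed), and freshness is checked against
   the remaining assumptions of that premise only.  The labels named in a rule,
   from which a fresh label must differ, include those in the sequence of its
   conclusion. *)
Inductive deriv : set generic -> generic -> Prop :=
| d_hyp phi : deriv [set phi] phi
| d_botE Gam (s1 s2 : lseq) A :
    deriv Gam (Lab s2 NBot) ->
    deriv (Gam `\` [set Lab s1 (NImp A NBot)]) (Lab s1 A)
| d_impI Gam (s : lseq) A B :
    deriv Gam (Lab s B) ->
    deriv (Gam `\` [set Lab s A]) (Lab s (NImp A B))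
| d_impE Gam1 Gam2 (s : lseq) A B :
    deriv Gam1 (Lab s (NImp A B)) ->
    deriv Gam2 (Lab s A) ->
    deriv (Gam1 `|` Gam2) (Lab s B)
| d_GI Gam (al : seq L) b1 b2 A :
    deriv Gam (Lab (rcons al b1, b2) A) ->
    b2 \notin [:: b1 & al] ->
    absent b2 (Gam `\` [set Le b1 b2]) ->
    deriv (Gam `\` [set Le b1 b2]) (Lab (al, b1) (NG A))
| d_GE Gam1 Gam2 (al : seq L) b1 b2 A :
    deriv Gam1 (Lab (al, b1) (NG A)) ->
    deriv Gam2 (Le b1 b2) ->
    deriv (Gam1 `|` Gam2) (Lab (rcons al b1, b2) A)
| d_XI Gam (al : seq L) b1 b2 A :
    deriv Gam (Lab (rcons al b1, b2) A) ->
    b2 \notin [:: b1 & al] ->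
    absent b2 (Gam `\` [set Succ b1 b2]) ->
    deriv (Gam `\` [set Succ b1 b2]) (Lab (al, b1) (NX A))
| d_XE Gam1 Gam2 (al : seq L) b1 b2 A :
    deriv Gam1 (Lab (al, b1) (NX A)) ->
    deriv Gam2 (Succ b1 b2) ->
    deriv (Gam1 `|` Gam2) (Lab (rcons al b1, b2) A)
| d_nablaI Gam (al : seq L) b1 b2 b3 A :
    deriv Gam (Lab (rcons al b1, b2) A) ->
    b2 \notin [:: b1, b3 & al] ->
    absent b2 (Gam `\` [set Le b1 b2; Le b2 b3]) ->
    deriv (Gam `\` [set Le b1 b2; Le b2 b3]) (Lab (rcons al b1, b3) (NNabla A))
| d_nablaE Gam1 Gam2 Gam3 (al : seq L) b1 b2 b3 A :
    deriv Gam1 (Lab (rcons al b1, b3) (NNabla A)) ->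
    deriv Gam2 (Le b1 b2) ->
    deriv Gam3 (Le b2 b3) ->
    deriv (Gam1 `|` Gam2 `|` Gam3) (Lab (rcons al b1, b2) A)
| d_ser Gam (s : lseq) b1 b2 A :
    deriv Gam (Lab s A) ->
    b2 \notin [:: b1 & labels_of s] ->
    absent b2 (Gam `\` [set Succ b1 b2]) ->
    deriv (Gam `\` [set Succ b1 b2]) (Lab s A)
| d_lin Gam1 Gam2 Gam3 Gam4 (s : lseq) b1 b2 b3 phi A :
    deriv Gam1 (Succ b1 b2) ->
    deriv Gam2 (Succ b1 b3) ->
    deriv Gam3 phi ->
    deriv Gam4 (Lab s A) ->
    deriv (Gam1 `|` Gam2 `|` Gam3 `|` (Gam4 `\` [set subst b3 b2 phi])) (Lab s A)
| d_refl Gam (s : lseq) b1 A :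
    deriv Gam (Lab s A) ->
    deriv (Gam `\` [set Le b1 b1]) (Lab s A)
| d_trans Gam1 Gam2 Gam3 (s : lseq) b1 b2 b3 A :
    deriv Gam1 (Le b1 b2) ->
    deriv Gam2 (Le b2 b3) ->
    deriv Gam3 (Lab s A) ->
    deriv (Gam1 `|` Gam2 `|` (Gam3 `\` [set Le b1 b3])) (Lab s A)
| d_last Gam (al be : seq L) b A :
    is_l A ->
    deriv Gam (Lab (be, b) A) ->
    deriv Gam (Lab (al, b) A)
| d_eq Gam1 Gam2 Gam3 (al : seq L) b1 b2 A :
    deriv Gam1 (Le b1 b2) ->
    deriv Gam2 (Le b2 b1) ->
    deriv Gam3 (Lab (al, b1) A) ->
    deriv (Gam1 `|` Gam2 `|` Gam3) (Lab (al, b2) A)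
| d_split Gam1 Gam2 Gam3 Gam4 (s : lseq) b1 b2 b' phi A :
    deriv Gam1 (Le b1 b2) ->
    deriv Gam2 phi ->
    deriv Gam3 (Lab s A) ->
    deriv Gam4 (Lab s A) ->
    b' \notin [:: b1, b2 & labels_of s] ->
    absent b' (Gam4 `\` [set Succ b1 b'; Le b' b2]) ->
    deriv (Gam1 `|` Gam2 `|` (Gam3 `\` [set subst b2 b1 phi])
             `|` (Gam4 `\` [set Succ b1 b'; Le b' b2])) (Lab s A)
| d_base Gam1 Gam2 (s : lseq) b1 b2 A :
    deriv Gam1 (Succ b1 b2) ->
    deriv Gam2 (Lab s A) ->
    deriv (Gam1 `|` (Gam2 `\` [set Le b1 b2])) (Lab s A)
| d_ind Gam1 Gam2 Gam3 (al : seq L) b0 b bi bj A :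
    deriv Gam1 (Lab (al, b0) A) ->
    deriv Gam2 (Le b0 b) ->
    deriv Gam3 (Lab (al, bj) A) ->
    bi \notin [:: b0, b & al] ->
    bj \notin [:: bi, b0, b & al] ->
    absent bi (Gam3 `\` [set Le b0 bi; Succ bi bj; Lab (al, bi) A]) ->
    absent bj (Gam3 `\` [set Le b0 bi; Succ bi bj; Lab (al, bi) A]) ->
    deriv (Gam1 `|` Gam2
             `|` (Gam3 `\` [set Le b0 bi; Succ bi bj; Lab (al, bi) A]))
          (Lab (al, b) A).

Definition star_at (b : L) (B : ltl P) : generic := Lab ([::], b) (star B).

(* [Gam] is the set of open assumptions actually used, [Phi] the set they are
   taken from. *)
Definition ltl_proves (Lam : set (ltl P)) (A : ltl P) : Prop :=
  exists (b : L) (Gam Phi : set generic),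
    [/\ deriv Gam (star_at b A),
        (forall phi, Gam phi -> exists B, phi = star_at b B),
        Gam `<=` Phi &
        Lam = [set B | Phi (star_at b B)]].

End Labels.

Arguments ltl_proves {P} L Lam A.

(* Main.v *)
Require Import Defs.
From mathcomp Require Import all_boot.
From mathcomp Require Import boolp classical_sets.

(** Labels are interpreted as arbitrary time points, and [LTL_nabla]-formulas
    are evaluated at nonempty sequences of time points: [G] and [X] append a
    point to the sequence, while [nabla A] makes the last point range over the
    interval between the last two points.  Every rule of the natural deduction
    system preserves truth for all interpretations, the rule [last] because the
    truth of an [LTL^l]-formula depends only on the last point.  On translated
    formulas this semantics agrees with that of [LTL] at the last point, so it
    remains to interpret the single label of an [LTL]-derivation by an
    arbitrary point. *)

Set Implicit Arguments.
Unset Strict Implicit.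
Unset Printing Implicit Defensive.

Local Open Scope classical_set_scope.

Section Semantics.
Variables (P : Type) (V : nat -> set P).

(* [nsat al n A]: truth of [A] at the sequence [al n].  The default value of
   [last] makes [nabla A] equivalent to [A] at one-point sequences; the rules
   for nabla never mention such sequences. *)
Fixpoint nsat (al : seq nat) (n : nat) (A : ltln P) : Prop :=
  match A with
  | NVar p => V n p
  | NBot => False
  | NImp A B => nsat al n A -> nsat al n B
  | NG A => forall m, n <= m -> nsat (rcons al n) m A
  | NX A => nsat (rcons al n) n.+1 A
  | NNabla A => forall m, last n al <= m <= n -> nsat al m A
  end.

Scheme is_l_mut := Minimality for is_l Sort Prop
  with is_ln_mut := Minimality for is_ln Sort Prop.

(** The induction follows the mutual grammar: an [is_ln] formula may look one step further back,
    depending on the last two points because of [NNabla]. Under [NG] and [NX] the current point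
    becomes the last but one, so the rest of the prefix is irrelevant. *)
Lemma nsat_last (A : ltln P) (al be : seq nat) n :
  is_l A -> nsat al n A = nsat be n A.
Proof.
move=> lA; move: A lA al be n.
apply: (@is_l_mut P (fun A => forall al be n, nsat al n A = nsat be n A)
  (fun A => forall al be k n,
     nsat (rcons al k) n A = nsat (rcons be k) n A)) => //=.
- by move=> A B _ IHA _ IHB al be n; rewrite (IHA al be) (IHB al be).
- by move=> A _ IHA al be n; apply: eq_forall => m; rewrite (IHA al be).
- by move=> A B _ IHA _ IHB al be k n; rewrite (IHA al be) (IHB al be).
- move=> A _ IHA al be k n; rewrite !last_rcons.
  by apply: eq_forall => m; rewrite (IHA al be).
Qed.

Lemma nsat_or al n (A B : ltln P) :
  nsat al n (NOr A B) <-> nsat al n A \/ nsat al n B.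
Proof.
split=> [/= AB|[?|?] //=].
by have [|nA] := EM (nsat al n A); [left | right; exact: AB].
Qed.

Lemma nsat_and al n (A B : ltln P) :
  nsat al n (NAnd A B) <-> nsat al n A /\ nsat al n B.
Proof.
split=> [/= AB|[hA hB] /= nAB]; last exact: nAB.
by split; apply: contrapT => nh; apply: AB.
Qed.

Lemma nsat_F al n (A : ltln P) :
  nsat al n (NF A) <-> exists2 m, n <= m & nsat (rcons al n) m A.
Proof.
split=> [/= nGA|[m nm hA] /= GnA]; last exact: GnA hA.
by apply: contrapT => nex; apply: nGA => m nm hA; apply: nex; exists m.
Qed.

(** Only until needs work. Its witness is either the current point [n] or a successor [m.+1] with
    [n <= m]; in the latter case [NNabla] at the sequence ending in [n], [m] covers exactly the
    points from [n] up to but excluding [m.+1]. *)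
Lemma nsat_star (A : ltl P) al n : nsat al n (star A) <-> sat V n A.
Proof.
elim: A al n => [p|| A IHA B IHB | A IHA | A IHA | A IHA B IHB] al n //.
- by rewrite /= (propext (IHA al n)) (propext (IHB al n)).
- by split=> /= h m nm; apply/IHA; apply: h.
- exact: IHA.
- split.
    case/nsat_or => [/IHB hB|/nsat_F [m nm /nsat_and [/IHB hB hA]]].
      (* With witness [n] no intermediate point remains. *)
      by exists n; split=> // m /andP[nm]; rewrite ltnNge nm.
    exists m.+1; split=> // [|k nk]; first exact: leqW.
    by apply/(IHA (rcons al n)); apply: hA; rewrite last_rcons.
  case=> m []; rewrite leq_eqVlt => /predU1P[<- hB _|].
    by apply/nsat_or; left; apply/IHB.
  (* A witness strictly after [n] is positive, and its predecessor serves as the witness for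
     [NF]. *)
  case: m => // m nm hB hA; apply/nsat_or; right; apply/nsat_F.
  exists m => //; apply/nsat_and; split; first exact/IHB.
  by move=> k; rewrite last_rcons => nk; apply/IHA; apply: hA.
Qed.

Variable L : eqType.
Implicit Types (lam : L -> nat) (phi : generic P L) (Gam H : set (generic P L)).

Definition holds lam phi : Prop :=
  match phi with
  | Lab s A => nsat (map lam s.1) (lam s.2) A
  | Le b c => lam b <= lam c
  | Succ b c => lam c = (lam b).+1
  end.

Definition holds_all lam Gam : Prop := forall phi, Gam phi -> holds lam phi.

(** Fresh labels are handled by moving them to a chosen point, which leaves all formulas without
    that label unaffected. *)
Definition upd lam b n : L -> nat := fun x => if x == b then n else lam x.

Lemma upd_same lam b n : upd lam b n b = n.
Proof. by rewrite /upd eqxx. Qed.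

Lemma upd_other lam b n x : x != b -> upd lam b n x = lam x.
Proof. by rewrite /upd => /negbTE ->. Qed.

Lemma map_upd lam b n (s : seq L) :
  b \notin s -> map (upd lam b n) s = map lam s.
Proof.
move=> bs; apply/eq_in_map => x xs; apply: upd_other.
by apply: contraNneq bs => <-.
Qed.

Lemma holds_upd lam b n phi :
  ~ occurs b phi -> holds (upd lam b n) phi = holds lam phi.
Proof.
case: phi => [[al c] A|c d|c d] /= /negP; rewrite ?mem_rcons !inE !negb_or.
- by move=> /andP[bc bal]; rewrite map_upd // upd_other // eq_sym.
- by move=> /andP[bc bd]; rewrite !upd_other // eq_sym.
- by move=> /andP[bc bd]; rewrite !upd_other // eq_sym.
Qed.

Lemma holds_all_upd lam b n Gam :
  absent b Gam -> holds_all lam Gam -> holds_all (upd lam b n) Gam.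
Proof.
move=> bGam hGam phi Gphi.
by rewrite holds_upd; [exact: hGam | exact: bGam].
Qed.

Lemma holds_subst lam b c phi :
  lam b = lam c -> holds lam (subst c b phi) = holds lam phi.
Proof.
move=> bc; have E x : lam (subst_label c b x) = lam x.
  by rewrite /subst_label; case: eqP => // ->.
case: phi => [[al d] A|d e|d e] /=; rewrite !E // -map_comp.
by congr nsat; apply: eq_map.
Qed.

Lemma holds_all1 lam phi : holds lam phi -> holds_all lam [set phi].
Proof. by move=> hphi _ ->. Qed.

Lemma holds_allU lam Gam H :
  holds_all lam (Gam `|` H) <-> holds_all lam Gam /\ holds_all lam H.
Proof.
split=> [h|[hG hH] phi [/hG|/hH] //].
by split=> phi hphi; apply: h; [left | right].
Qed.

Lemma holds_all_discharge lam Gam H :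
  holds_all lam (Gam `\` H) -> holds_all lam H -> holds_all lam Gam.
Proof.
move=> hGam hH phi Gphi; have [/hH //|nH] := EM (H phi).
exact: hGam.
Qed.

(** Induction on the derivation, with [lam] quantified inside so that the induction hypotheses apply
    to interpretations updated at fresh labels. *)
Lemma deriv_sound Gam phi :
  deriv Gam phi -> forall lam, holds_all lam Gam -> holds lam phi.
Proof.
elim=> {Gam phi}.
- by move=> phi lam; apply.
- move=> Gam s1 s2 A _ IH lam hG /=; apply: contrapT => nA.
  by apply: (IH lam); apply: holds_all_discharge hG _; exact: holds_all1.
- move=> Gam s A B _ IH lam hG /= hA.
  by apply: (IH lam); apply: holds_all_discharge hG _; exact: holds_all1.
- move=> G1 G2 s A B _ IH1 _ IH2 lam /holds_allU[h1 h2].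
  exact: (IH1 lam h1 (IH2 lam h2)).
- move=> Gam al b1 b2 A _ IH; rewrite inE negb_or => /andP[b21 b2al] fresh.
  move=> lam hG /= m lem; have b12 : b1 != b2 by rewrite eq_sym.
  (* The fresh [b2] stands for an arbitrary [m] not before [lam b1]. *)
  have := IH (upd lam b2 m).
  rewrite /= map_rcons upd_same upd_other // map_upd //; apply.
  apply: holds_all_discharge (holds_all_upd _ fresh hG) _.
  by apply: holds_all1; rewrite /= upd_same upd_other.
- move=> G1 G2 al b1 b2 A _ IH1 _ IH2 lam /holds_allU[h1 h2].
  by rewrite /= map_rcons; exact: (IH1 lam h1 _ (IH2 lam h2)).
- move=> Gam al b1 b2 A _ IH; rewrite inE negb_or => /andP[b21 b2al] fresh.
  move=> lam hG /=; have b12 : b1 != b2 by rewrite eq_sym.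
  have := IH (upd lam b2 (lam b1).+1).
  rewrite /= map_rcons upd_same upd_other // map_upd //; apply.
  apply: holds_all_discharge (holds_all_upd _ fresh hG) _.
  by apply: holds_all1; rewrite /= upd_same upd_other.
- move=> G1 G2 al b1 b2 A _ IH1 _ IH2 lam /holds_allU[h1 h2].
  by rewrite /= map_rcons (IH2 lam h2); exact: (IH1 lam h1).
- move=> Gam al b1 b2 b3 A _ IH; rewrite !inE !negb_or.
  move=> /and3P[b21 b23 b2al] fresh lam hG /= m.
  have [b12 b32] : b1 != b2 /\ b3 != b2 by rewrite eq_sym b21 eq_sym b23.
  rewrite map_rcons last_rcons => /andP[le1 le2].
  have := IH (upd lam b2 m).
  rewrite /= map_rcons upd_same upd_other // map_upd //; apply.
  apply: holds_all_discharge (holds_all_upd _ fresh hG) _.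
  by apply/holds_allU; split; apply: holds_all1; rewrite /= upd_same upd_other.
- move=> G1 G2 G3 al b1 b2 b3 A _ IH1 _ IH2 _ IH3 lam.
  move=> /holds_allU[/holds_allU[h1 h2] h3].
  apply: (IH1 lam h1); rewrite map_rcons last_rcons.
  by apply/andP; split; [exact: (IH2 lam h2) | exact: (IH3 lam h3)].
- move=> Gam s b1 b2 A _ IH; rewrite inE negb_or => /andP[b21 b2s] fresh.
  move=> lam hG; have b12 : b1 != b2 by rewrite eq_sym.
  (* The conclusion does not mention [b2], which may thus be placed at the successor of [lam b1]. *)
  rewrite -(@holds_upd lam b2 (lam b1).+1); last exact/negP.
  apply: IH; apply: holds_all_discharge (holds_all_upd _ fresh hG) _.
  by apply: holds_all1; rewrite /= upd_same upd_other.
- move=> G1 G2 G3 G4 s b1 b2 b3 phi A _ IH1 _ IH2 _ IH3 _ IH4 lam.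
  move=> /holds_allU[/holds_allU[/holds_allU[h1 h2] h3] h4].
  apply: IH4; apply: holds_all_discharge h4 _; apply: holds_all1.
  rewrite holds_subst; first exact: IH3.
  (* Successors are unique, so [b2] and [b3] denote the same point. *)
  exact: etrans (IH1 lam h1) (esym (IH2 lam h2)).
- move=> Gam s b1 A _ IH lam hG; apply: IH.
  by apply: holds_all_discharge hG _; apply: holds_all1 => /=.
- move=> G1 G2 G3 s b1 b2 b3 A _ IH1 _ IH2 _ IH3 lam.
  move=> /holds_allU[/holds_allU[h1 h2] h3].
  apply: IH3; apply: holds_all_discharge h3 _; apply: holds_all1.
  exact: leq_trans (IH1 lam h1) (IH2 lam h2).
- move=> Gam al be b A lA _ IH lam hG /=.
  by rewrite (nsat_last _ (map lam be)) //; exact: (IH lam hG).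
- move=> G1 G2 G3 al b1 b2 A _ IH1 _ IH2 _ IH3 lam.
  move=> /holds_allU[/holds_allU[h1 h2] h3] /=.
  have -> : lam b2 = lam b1.
    by apply/eqP; rewrite eqn_leq (IH2 lam h2) (IH1 lam h1).
  exact: (IH3 lam h3).
- move=> G1 G2 G3 G4 s b1 b2 b' phi A _ IH1 _ IH2 _ IH3 _ IH4.
  rewrite !inE !negb_or => /and3P[b'1 b'2 b's] fresh lam.
  move=> /holds_allU[/holds_allU[/holds_allU[h1 h2] h3] h4].
  have [b1' b2'] : b1 != b' /\ b2 != b' by rewrite eq_sym b'1 eq_sym b'2.
  have := IH1 lam h1; rewrite /= leq_eqVlt => /predU1P[eq12|lt12].
    apply: IH3; apply: holds_all_discharge h3 _; apply: holds_all1.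
    by rewrite holds_subst //; exact: IH2.
  (* If [lam b1 < lam b2], the successor of [lam b1] is still at most [lam b2]. *)
  have := IH4 (upd lam b' (lam b1).+1).
  rewrite holds_upd; last exact/negP.
  apply; apply: holds_all_discharge (holds_all_upd _ fresh h4) _.
  by apply/holds_allU; split; apply: holds_all1; rewrite /= upd_same upd_other.
- move=> G1 G2 s b1 b2 A _ IH1 _ IH2 lam /holds_allU[h1 h2].
  apply: IH2; apply: holds_all_discharge h2 _; apply: holds_all1.
  by rewrite /= (IH1 lam h1).
- move=> G1 G2 G3 al b0 b bi bj A _ IH1 _ IH2 _ IH3.
  rewrite !inE !negb_or => /and3P[bi0 _ bial] /and4P[bji bj0 _ bjal].
  move=> freshi freshj lam /holds_allU[/holds_allU[h1 h2] h3] /=.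
  have [b0i b0j bij] : [/\ b0 != bi, b0 != bj & bi != bj].
    by rewrite eq_sym bi0 eq_sym bj0 eq_sym bji.
  have hind n : lam b0 <= n -> nsat (map lam al) n A.
    elim: n => [|n IHn].
      by rewrite leqn0 => /eqP <-; exact: (IH1 lam h1).
    rewrite leq_eqVlt => /predU1P[<-|le0n]; first exact: (IH1 lam h1).
    (* The step premise, with [bi] at [n] and [bj] at [n.+1], is the inductive step on natural
       numbers starting from [lam b0]. *)
    have := IH3 (upd (upd lam bi n) bj n.+1).
    rewrite /= upd_same !map_upd //; apply.
    apply: holds_all_discharge
      (holds_all_upd _ freshj (holds_all_upd _ freshi h3)) _.
    apply/holds_allU; split; first (apply/holds_allU; split);
      apply: holds_all1 => /=.
    + by rewrite !(upd_other _ _ b0j, upd_other _ _ b0i, upd_other _ _ bij)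
        upd_same.
    + by rewrite (upd_other _ _ bij) !upd_same.
    + by rewrite (upd_other _ _ bij) upd_same !map_upd //; exact: IHn.
  exact: hind (IH2 lam h2).
Qed.

End Semantics.

Theorem theorem3 (P : Type) (L : eqType) (hL : denumerable L)
    (Lam : set (ltl P)) (A : ltl P) :
  ltl_proves L Lam A -> ltl_entails Lam A.
Proof.
move=> [b [Gam [Phi [dA GamE GamPhi ->]]]] V hV n.
apply/(nsat_star V A [::]).
(* Conclusion and open assumptions all carry the single label [b], so sending every label to [n]
   suffices. *)
apply: (deriv_sound dA (V := V) (lam := fun=> n)) => phi Gphi.
have [B EB] := GamE _ Gphi; subst phi.
by apply/nsat_star; apply: hV; exact: GamPhi.
Qed.
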